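(* There exists an algorithm for the ordinal matroid secretary problem (on arbitrary matroids) that is $\frac{1}{1-\ln 2}=\frac{1}{\ln(e/2)}$ intersection-competitive, i.e., $\mathbb{E}[|\mathrm{OPT}\cap\mathrm{ALG}|]\ge \ln(e/2)\,|\mathrm{OPT}|$.
   Context: Ordinal MSP: $\mathcal{M}=(R,\mathcal{I})$ is a matroid with $|R|=n$ and rank $\rho$, $\succ$ a total order on $R$. For $Q\subseteq R$, $\mathrm{OPT}(Q)$ is the greedy (lexicographically maximum w.r.t. $\succ$) base of $Q$ and $\mathrm{OPT}=\mathrm{OPT}(R)$. Elements arrive in uniformly random order $r_1,\dots,r_n$; the algorithm knows $n$, can only compare revealed elements under $\succ$ and query independence of sets of revealed elements, and must irrevocably accept or reject each element on arrival keeping the accepted set $\mathrm{ALG}$ independent. An algorithm is $\alpha$ intersection-competitive if $\mathbb{E}[|\mathrm{OPT}\cap\mathrm{ALG}|]\ge|\mathrm{OPT}|/\alpha$. *)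

(* Defs.v *)
From mathcomp Require Import all_boot all_order all_algebra.
From mathcomp Require Import reals sequences exp.

Set Implicit Arguments.
Unset Strict Implicit.
Unset Printing Implicit Defensive.

Import Order.TTheory GRing.Theory Num.Theory.
Local Open Scope ring_scope.

(* The ground set is the whole finite type T; loops are allowed. *)
Record matroid (T : finType) := Matroid {
  indep : pred {set T};
  indep0 : indep set0;
  indepS : forall A B : {set T}, B \subset A -> indep A -> indep B;
  indep_aug : forall A B : {set T}, indep A -> indep B -> (#|A| < #|B|)%N ->
    exists2 x, x \in B :\: A & indep (x |: A)
}.

(* The total order on the ground set is the canonical order of
   T : finOrderType d, and "x is preferred to y" reads (y < x)%O. *)

(* Scan Q from the most to the least preferred element and keep each element
   that preserves independence; the result is the lexicographically maximum
   base of Q. *)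
Definition OPT d (T : finOrderType d) (M : matroid T) (Q : {set T}) : {set T} :=
  foldl (fun S x => if indep M (x |: S) then x |: S else S) set0
        (sort (fun x y => (y <= x)%O) (enum Q)).

(* What comparisons and independence queries can reveal about the first m
   arrivals.  Arrivals are named only by their position 'I_m, so the identity
   of the elements carries no information. *)
Record observation (m : nat) := Observation {
  obs_pref : {set 'I_m * 'I_m};
  obs_indep : {set {set 'I_m}}
}.

(* x j is the j-th arrival; (j, k) \in obs_pref iff x j is preferred to x k. *)
Definition observe d (T : finOrderType d) (M : matroid T) (m : nat)
    (x : 'I_m -> T) : observation m :=
  {| obs_pref := [set p | (x p.2 < x p.1)%O];
     obs_indep := [set J : {set 'I_m} | indep M (x @: J)] |}.

(* An online algorithm may be randomized.  For each size n of the ground set,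
   known in advance, it draws a seed independent of the arrival order; the
   decision on the m-th arrival is a function of n, the seed and the
   observation of the first m arrivals.  Earlier decisions need not be passed
   along, being functions of the same data.  Finite seed spaces lose no
   generality: for fixed n there are finitely many observations, hence finitely
   many deterministic behaviours. *)
Record algorithm (R : realType) := Algorithm {
  seed : nat -> finType;
  seed_prob : forall n, seed n -> R;
  seed_prob_ge0 : forall n (w : seed n), 0 <= seed_prob w;
  seed_prob_sum1 : forall n, \sum_(w : seed n) seed_prob w = 1;
  accept : forall n, seed n -> forall m, observation m -> bool
}.

(* An arrival order of the whole ground set is an injective
   r : {ffun 'I_#|T| -> T}, r i being the (i+1)-st arrival. *)
Definition arrival_orders (T : finType) : {set {ffun 'I_#|T| -> T}} :=
  [set r : {ffun 'I_#|T| -> T} | injectiveb r].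

Definition revealed (T : finType) (r : {ffun 'I_#|T| -> T}) (i : 'I_#|T|) :
    'I_i.+1 -> T :=
  fun j => r (widen_ord (ltn_ord i) j).

Definition ALG (R : realType) (A : algorithm R) d (T : finOrderType d)
    (M : matroid T) (w : seed A #|T|) (r : {ffun 'I_#|T| -> T}) : {set T} :=
  [set r i | i : 'I_#|T| & accept w (observe M (revealed r (i := i)))].

(* By heredity, independence of the final set is independence of the accepted
   set at every step. *)
Definition feasible (R : realType) (A : algorithm R) : Prop :=
  forall d (T : finOrderType d) (M : matroid T) (w : seed A #|T|)
         (r : {ffun 'I_#|T| -> T}),
    r \in arrival_orders T -> indep M (ALG M w r).

(* E[|OPT :&: ALG|] over the seed and a uniformly random arrival order. *)
Definition expected_intersection (R : realType) (A : algorithm R) d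
    (T : finOrderType d) (M : matroid T) : R :=
  \sum_(w : seed A #|T|) seed_prob w *
    (#|arrival_orders T|%:R^-1 *
     \sum_(r in arrival_orders T) #|OPT M [set: T] :&: ALG M w r|%:R).

Definition intersection_competitive (R : realType) (alpha : R)
    (A : algorithm R) : Prop :=
  forall d (T : finOrderType d) (M : matroid T),
    #|OPT M [set: T]|%:R / alpha <= expected_intersection A M.

(* Main.v *)
(* Reject the first h = n/2 arrivals; afterwards call the arrival r_k, with
   R_k the set of the first k arrivals, a candidate when it lies in OPT(R_k),
   and accept candidates greedily, so that ALG is a maximal independent subset
   of the candidate set K.  Late elements of OPT are candidates, hence
   |ALG| = rank K >= |OPT \ R_h|, while ALG \ OPT is contained in K \ OPT.
   Therefore |OPT n ALG| >= 2 |OPT \ R_h| - |K|.  By symmetry between the first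
   k positions, r_k is a candidate with probability at most rank / k, so the
   expectation is at least
     rank * (2 (n - h) / n - \sum_(h < k <= n) 1 / k) >= rank * (1 - ln 2). *)
Require Import Defs.
From mathcomp Require Import all_boot all_order all_algebra.
From mathcomp Require Import perm reals sequences exp.

Set Implicit Arguments.
Unset Strict Implicit.
Unset Printing Implicit Defensive.

Import Order.TTheory GRing.Theory Num.Theory.
Local Open Scope ring_scope.

(** * Matroid rank and greedy bases *)

Section Rank.
Variables (T : finType) (M : matroid T).
Implicit Types (A B I : {set T}) (x : T).

Definition rank A : nat := \max_(I : {set T} | (I \subset A) && indep M I) #|I|.

Lemma leq_rank A I : I \subset A -> indep M I -> (#|I| <= rank A)%N.
Proof. by move=> sIA indI; apply: leq_bigmax_cond; rewrite sIA. Qed.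

Lemma rank_aug A I : indep M I -> (#|I| < rank A)%N ->
  exists2 x, x \in A :\: I & indep M (x |: I).
Proof.
rewrite /rank; have [|J /andP[sJA indJ] ->] :=
  @eq_bigmax_cond _ (fun J : {set T} => (J \subset A) && indep M J)
    (fun J : {set T} => #|J|).
  by apply/card_gt0P; exists set0; rewrite unfold_in /= sub0set indep0.
move=> indI ltIJ; have [x xJI indxI] := indep_aug indI indJ ltIJ.
by exists x => //; apply: subsetP xJI; apply: setSD.
Qed.

Lemma rank_extend A I : I \subset A -> indep M I ->
  exists2 B : {set T}, I \subset B & [/\ B \subset A, indep M B & #|B| = rank A].
Proof.
move: {2}(rank A - #|I|)%N (leqnn (rank A - #|I|)%N) => m.
elim: m I => [|m IHm] I lem sIA indI; have leI := leq_rank sIA indI.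
  by exists I => //; split=> //; apply/eqP; rewrite eqn_leq leI -subn_eq0 -leqn0.
have [ltI|geI] := ltnP #|I| (rank A); last first.
  by exists I => //; split=> //; apply/eqP; rewrite eqn_leq leI.
have [x /setDP[xA xNI] indxI] := rank_aug indI ltI.
have [||//|B sxIB Bbase] := IHm (x |: I).
- by rewrite cardsU1 xNI add1n subnS -ltnS prednK ?subn_gt0.
- by rewrite subUset sub1set xA.
by exists B => //; apply: subset_trans sxIB; apply: subsetUr.
Qed.

Lemma rankS A B : A \subset B -> (rank A <= rank B)%N.
Proof.
move=> sAB; have [I _ [sIA indI <-]] := rank_extend (sub0set A) (indep0 M).
by apply: leq_rank => //; apply: subset_trans sAB.
Qed.

Lemma rank_indep I : indep M I -> rank I = #|I|.
Proof.
move=> indI; apply/eqP; rewrite eqn_leq leq_rank // andbT.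
by apply/bigmax_leqP => J /andP[/subset_leq_card].
Qed.

(** An augmenting element taken from [A] would contradict the maximality of [I], so it must be [x].
    This trades independence over a chosen base for a rank gain, in which no base appears. *)
Lemma rank_base_extend A I x : I \subset A -> indep M I -> #|I| = rank A ->
  x \notin I -> indep M (x |: I) = (rank A < rank (x |: A))%N.
Proof.
move=> sIA indI cardI xNI; apply/idP/idP => [indxI|ltA].
  by have := leq_rank (setUS [set x] sIA) indxI; rewrite cardsU1 xNI cardI.
rewrite -cardI in ltA; have [y /setDP[yxA yNI] indyI] := rank_aug indI ltA.
have [<-//|neyx] := eqVneq y x; have yA : y \in A.
  by move: yxA; rewrite !inE (negPf neyx).
have /leq_rank/(_ indyI) : y |: I \subset A by rewrite subUset sub1set yA.
by rewrite cardsU1 yNI cardI ltnn.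
Qed.

(** Diminishing returns: a base [I] of [B] extends to a base [J] of [A], and independence of
    [x |: J] passes down to [x |: I]. *)
Lemma rank_gainS A B x : B \subset A ->
  (rank A < rank (x |: A))%N -> (rank B < rank (x |: B))%N.
Proof.
move=> sBA ltA.
have [I _ [sIB indI cardI]] := rank_extend (sub0set B) (indep0 M).
have [J sIJ [sJA indJ cardJ]] := rank_extend (subset_trans sIB sBA) indI.
have xNA : x \notin A.
  by apply: contraTN ltA => xA; rewrite (setUidPr _) ?sub1set // ltnn.
have xNJ : x \notin J := contra (subsetP sJA x) xNA.
have xNI : x \notin I := contra (subsetP sIJ x) xNJ.
rewrite -(rank_base_extend sIB) //.
by apply: indepS (setUS _ sIJ) _; rewrite (rank_base_extend sJA).
Qed.

(** The scan of [OPT] over an arbitrary list, to serve both for the preference order and for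
    candidates in arrival order. *)
Definition greedy (l : seq T) : {set T} :=
  foldl (fun S x => if indep M (x |: S) then x |: S else S) set0 l.

Lemma greedy_rcons l x : greedy (rcons l x) =
  if indep M (x |: greedy l) then x |: greedy l else greedy l.
Proof. by rewrite /greedy foldl_rcons. Qed.

Lemma set_rcons l x : [set y in rcons l x] = x |: [set y in l].
Proof. by apply/setP=> y; rewrite !inE mem_rcons inE. Qed.

Lemma greedy_base l : [/\ greedy l \subset [set x in l],
  indep M (greedy l) & #|greedy l| = rank [set x in l]].
Proof.
elim/last_ind: l => [|l x [sGl indG cardG]].
  by rewrite sub0set indep0 /greedy /= set_nil rank_indep ?indep0.
rewrite greedy_rcons set_rcons.
have [xG|xNG] := boolP (x \in greedy l).
  rewrite (setUidPr _) ?sub1set // (setUidPr _) ?if_same //.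
  by rewrite sub1set (subsetP sGl).
have ext := rank_base_extend sGl indG cardG xNG.
case: ifPn => indx.
  split=> //; first exact: setUS.
  apply/eqP; rewrite eqn_leq leq_rank ?setUS //= cardsU1 xNG cardG.
  (* If the rank rose by two or more, some [y] from [l] would augment [x |: greedy l], hence also
     [greedy l], which is already maximal in [l]. *)
  rewrite add1n leqNgt; apply/negP => gt2.
  have [|y /setDP[yA yNI] indy] := @rank_aug (x |: [set z in l]) (x |: greedy l) indx.
    by rewrite cardsU1 xNG cardG add1n.
  have yl : y \in [set z in l].
    by move: yA yNI; rewrite !inE; case: (y == x).
  have syGl : y |: greedy l \subset [set z in l] by rewrite subUset sub1set yl.
  have yNG : y \notin greedy l by apply: contra yNI => yG; rewrite inE yG orbT.
  have indyG : indep M (y |: greedy l).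
    by apply: indepS indy; rewrite setUCA subsetUr.
  by have := leq_rank syGl indyG; rewrite cardsU1 yNG cardG add1n ltnn.
split=> //; first exact: subset_trans (subsetUr _ _).
by apply/eqP; rewrite eqn_leq cardG rankS ?subsetUr //= leqNgt -ext.
Qed.

(** When an element is scanned, the greedy set is a base of what precedes it, and later elements
    never alter its fate. Membership thus depends on the set of predecessors only, not on the
    history of the scan. *)
Lemma mem_greedy_sorted (e : rel T) l x :
    transitive e -> irreflexive e -> sorted e l ->
  (x \in greedy l) = (x \in l) &&
    (rank [set y in l | e y x] < rank (x |: [set y in l | e y x]))%N.
Proof.
move=> e_tr e_irr; rewrite sorted_pairwise //.
elim/last_ind: l => [|l z IHl]; first by rewrite /greedy /= inE.
rewrite pairwise_rcons => /andP[/allP le_z pw_l].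
have [sGl indG cardG] := greedy_base l.
have zNl : z \notin l by apply/negP => /le_z; rewrite e_irr.
have zNG : z \notin greedy l.
  by apply: contra zNl => /(subsetP sGl); rewrite inE.
have -> : (x \in greedy (rcons l z)) =
    (x \in greedy l) || (x == z) && indep M (x |: greedy l).
  rewrite greedy_rcons; case: (eqVneq x z) => [->|ne]; case: ifP => //=.
  - by rewrite !inE eqxx orbT.
  - by rewrite orbF.
  - by rewrite !inE (negPf ne) orbF.
  by rewrite orbF.
rewrite mem_rcons inE; case: (eqVneq x z) => [->|ne] /=.
  rewrite (negPf zNG) /= (rank_base_extend sGl) //.
  suff -> : [set y in rcons l z | e y z] = [set y in l] by [].
  apply/setP => y; rewrite !inE mem_rcons inE.
  case: eqVneq => [->|_] /=; first by rewrite e_irr (negPf zNl).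
  by apply/andP/idP => [[]|yl] //; rewrite yl le_z.
rewrite orbF IHl //; case xl: (x \in l) => //=.
suff -> : [set y in rcons l z | e y x] = [set y in l | e y x] by [].
apply/setP => y; rewrite !inE mem_rcons inE; case: eqVneq => [->|_] //=.
rewrite (negPf zNl); apply/negP => ezx.
by have := e_tr _ _ _ ezx (le_z _ xl); rewrite e_irr.
Qed.

End Rank.

(** * The optimum of a subset *)

Section Opt.
Variables (d : Order.disp_t) (T : finOrderType d) (M : matroid T).
Implicit Type Q : {set T}.

Lemma card_OPT Q : #|OPT M Q| = rank M Q.
Proof.
have [_ _ ->] := greedy_base M (sort (fun x y => (y <= x)%O) (enum Q)).
by congr (rank M _); apply/setP => x; rewrite inE mem_sort mem_enum.
Qed.

Lemma OPT_indep Q : indep M (OPT M Q).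
Proof. by have [] := greedy_base M (sort (fun x y => (y <= x)%O) (enum Q)). Qed.

Lemma mem_OPT Q x : (x \in OPT M Q) = (x \in Q) &&
  (rank M [set y in Q | (x < y)%O] < rank M (x |: [set y in Q | (x < y)%O]))%N.
Proof.
(* [sort] yields only the non-strict order; strictness comes from the absence of duplicates in
   [enum Q]. *)
have sortQ : sorted (fun x y => (y < x)%O) (sort (fun x y => (y <= x)%O) (enum Q)).
  have /sort_sorted/(_ (enum Q)) : total (fun x y : T => (y <= x)%O).
    by move=> a b; apply: le_total.
  have := enum_uniq Q; rewrite -(sort_uniq (fun x y => (y <= x)%O)).
  set l := sort _ _; case: l => //= a l; elim: l a => //= b l IHl a.
  rewrite inE negb_or -andbA => /and4P[neab _ bNl ul] /andP[leba pl].
  by rewrite lt_neqAle eq_sym neab leba IHl ?bNl.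
rewrite (mem_greedy_sorted _ _ _ _ sortQ); first last.
- by move=> a; apply: ltxx.
- by move=> a b c /= ab bc; apply: lt_trans bc ab.
rewrite mem_sort mem_enum; congr (_ && _).
suff -> : [set y in sort (fun x y => (y <= x)%O) (enum Q) | (x < y)%O] =
  [set y in Q | (x < y)%O] by [].
by apply/setP => y; rewrite !inE mem_sort mem_enum.
Qed.

Lemma OPT_subset Q : OPT M Q \subset Q.
Proof. by apply/subsetP => x; rewrite mem_OPT => /andP[]. Qed.

(** Passing to [Q] only removes competitors preferred to [x], so [rank_gainS] keeps the gain of [x].
    This makes late optimal elements candidates. *)
Lemma OPT_restrict Q x : x \in Q -> x \in OPT M [set: T] -> x \in OPT M Q.
Proof.
rewrite !mem_OPT inE /= => -> /=; apply: rank_gainS.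
by apply/subsetP => y; rewrite !inE => /andP[].
Qed.

End Opt.

(** * Decisions computed from observations *)

Definition obs_rank m (o : observation m) (J : {set 'I_m}) : nat :=
  \max_(I : {set 'I_m} | (I \subset J) && (I \in obs_indep o)) #|I|.

(* The rank tests decide whether the j-th arrival is in the OPT of its prefix
   (mem_OPT) and whether it enlarges the span of the earlier candidates; they
   avoid replaying the earlier decisions of the algorithm. *)
Definition obs_candidates n m (o : observation m) : {set 'I_m} :=
  [set j : 'I_m | let B := [set l : 'I_m | (l <= j)%N & (l, j) \in obs_pref o] in
    (n./2 <= j)%N && (obs_rank o B < obs_rank o (j |: B))%N].

(** The condition [j.+1 == m] picks out the newest arrival, so [C :\ j] holds the earlier
    candidates. *)
Definition obs_accept n m (o : observation m) : bool :=
  let C := obs_candidates n o in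
  [exists j : 'I_m, [&& j.+1 == m, j \in C & (obs_rank o (C :\ j) < obs_rank o C)%N]].

Lemma obs_rankE d (T : finOrderType d) (M : matroid T) m (x : 'I_m -> T) J :
  injective x -> obs_rank (observe M x) J = rank M (x @: J).
Proof.
move=> x_inj; apply/eqP; rewrite eqn_leq; apply/andP; split.
  apply/bigmax_leqP => I /andP[sIJ]; rewrite inE => indI.
  by rewrite -(card_imset I x_inj); apply: leq_rank; rewrite // imsetS.
have [B _ [sBJ indB <-]] := rank_extend (sub0set (x @: J)) (indep0 M).
have defB : B = x @: (J :&: x @^-1: B).
  apply/setP => y; apply/idP/imsetP => [yB|[j]]; last by rewrite !inE => /andP[_ ?] ->.
  have /imsetP[j jJ ej] := subsetP sBJ y yB.
  by exists j; rewrite // !inE jJ -ej.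
rewrite defB card_imset // /obs_rank.
apply: (@leq_bigmax_cond _ (fun I : {set 'I_m} =>
  (I \subset J) && (I \in obs_indep (observe M x))) (fun I : {set 'I_m} => #|I|)).
by rewrite subsetIl inE -defB.
Qed.

(** * Analysis of one fixed arrival order *)

Section Online.
Variables (d : Order.disp_t) (T : finOrderType d) (M : matroid T).
Variable r : {ffun 'I_#|T| -> T}.
Hypothesis r_inj : injective r.

Definition prefix (i : 'I_#|T|) : {set T} := r @: [set j : 'I_#|T| | (j <= i)%N].

Definition candidates : {set 'I_#|T|} :=
  [set i : 'I_#|T| | (#|T|./2 <= i)%N & r i \in OPT M (prefix i)].

(** Convertible to the [ALG] of [threshold_algorithm] at [r]. *)
Definition online : {set T} :=
  [set r i | i : 'I_#|T| & obs_accept #|T| (observe M (revealed r (i := i)))].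

Lemma revealed_inj i : injective (revealed r (i := i)).
Proof. by move=> j k /r_inj /(congr1 val) /= /val_inj. Qed.

(** All arrivals up to [j] are revealed by time [i], and the test of [mem_OPT] involves no others,
    so a later observation recovers earlier candidacies exactly. *)
Lemma mem_obs_candidates (i : 'I_#|T|) (j : 'I_i.+1) :
  (j \in obs_candidates #|T| (observe M (revealed r (i := i)))) =
  (widen_ord (ltn_ord i) j \in candidates).
Proof.
rewrite !inE /= !obs_rankE; try exact: revealed_inj.
congr (_ && _); rewrite mem_OPT imset_f ?inE //= imsetU1.
set x := r (widen_ord _ j).
suff -> : revealed r (i:=i) @: [set l : 'I_i.+1 | (l <= j)%N & (l, j) \in
      [set p | (revealed r (i:=i) p.2 < revealed r (i:=i) p.1)%O]] =
    [set y in prefix (widen_ord (ltn_ord i) j) | (x < y)%O] by [].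
apply/setP => y; rewrite inE; apply/imsetP/andP.
  move=> [l]; rewrite !inE /= => /andP[lej ltl] ->; split=> //.
  by apply: imset_f; rewrite inE.
move=> [/imsetP[k]]; rewrite inE /= => lekj ey ltxy.
have ltki : (k < i.+1)%N by rewrite ltnS (leq_trans lekj) // -ltnS.
have ek : r k = revealed r (Ordinal ltki) by congr (r _); apply: val_inj.
by exists (Ordinal ltki); rewrite ?ey // !inE /= lekj -ek -ey.
Qed.

Lemma obs_acceptE i : obs_accept #|T| (observe M (revealed r (i := i))) =
  (i \in candidates) &&
  (rank M (r @: [set j in candidates | (j < i)%N]) <
   rank M (r i |: r @: [set j in candidates | (j < i)%N]))%N.
Proof.
set o := observe M _; set C := obs_candidates #|T| o.
have widen_max : widen_ord (ltn_ord i) ord_max = i by apply: val_inj.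
have imC (P : pred nat) : revealed r (i := i) @: [set j in C | P j] =
    r @: [set j in candidates | (j <= i)%N && P j].
  apply/setP => y; apply/imsetP/imsetP => -[j].
    rewrite inE mem_obs_candidates => /andP[jC Pj] ->.
    by exists (widen_ord (ltn_ord i) j); rewrite // inE jC /= -ltnS ltn_ord.
  rewrite inE => /and3P[jC leji Pj] ->; have ltji : (j < i.+1)%N by [].
  have ej : widen_ord (ltn_ord i) (Ordinal ltji) = j by apply: val_inj.
  exists (Ordinal ltji); last by rewrite /revealed ej.
  by rewrite inE mem_obs_candidates ej jC.
have imCmax : revealed r (i := i) @: (C :\ ord_max) =
    r @: [set j in candidates | (j < i)%N].
  rewrite (_ : C :\ _ = [set j in C | (j < i)%N]).
    rewrite (imC (fun k => (k < i)%N)); congr (_ @: pred_of_set _).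
    apply/setP => j; rewrite inE [in RHS]inE; congr (_ && _).
    by apply/andP/idP => [[]//|ltji]; rewrite ltnW.
  apply/setP => j; rewrite in_setD1 [in RHS]inE andbC ltn_neqAle -ltnS ltn_ord andbT.
  by rewrite -val_eqE.
have ext : (obs_rank o (C :\ ord_max) < obs_rank o (ord_max |: (C :\ ord_max)))%N =
    (rank M (r @: [set j in candidates | (j < i)%N]) <
     rank M (r i |: r @: [set j in candidates | (j < i)%N]))%N.
  rewrite !obs_rankE ?imsetU1 ?imCmax; try exact: revealed_inj.
  by rewrite /revealed widen_max.
have memC : (ord_max \in C) = (i \in candidates).
  by rewrite mem_obs_candidates widen_max.
rewrite -ext -memC; apply/existsP/andP.
  move=> [j /and3P[/eqP[ej] jC lt]].
  have ejm : j = ord_max by apply: val_inj; rewrite /= ej.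
  by rewrite -ejm setD1K.
by move=> [mC]; rewrite setD1K // => lt; exists ord_max; rewrite mC lt /= eqxx.
Qed.

(** [obs_acceptE] and [mem_greedy_sorted] reduce both sides to the same rank test. Independence and
    size of the accepted set then come from [greedy_base]. *)
Lemma onlineE : online = greedy M [seq r i | i <- enum candidates].
Proof.
have [g rK gK] : bijective r by apply: inj_card_bij; rewrite // card_ord.
(* The scan order is arrival time, read through the inverse [g] of [r], not preference. *)
pose e : rel T := fun y x => (g y < g x)%N.
have sorted_cand : sorted e [seq r i | i <- enum candidates].
  rewrite sorted_map; apply: (@subseq_sorted _ (relpre r e) _ (enum candidates) (enum 'I_#|T|)).
  - by move=> a b c /=; rewrite /e; apply: ltn_trans.
  - by rewrite enumT; apply: filter_subseq.
  rewrite (@eq_sorted _ _ (relpre val ltn)) => [|a b]; last by rewrite /= /e !rK.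
  by rewrite -sorted_map val_enum_ord iota_ltn_sorted.
apply/setP => x; rewrite -[x]gK; move: (g x) => {x} i.
rewrite (mem_greedy_sorted _ _ _ _ sorted_cand); first last.
- by move=> a; rewrite /e ltnn.
- by move=> a b c; rewrite /e; apply: ltn_trans.
rewrite mem_map // mem_enum mem_imset // inE /= obs_acceptE.
suff -> : [set y in [seq r i0 | i0 <- enum candidates] | e y (r i)] =
  r @: [set j in candidates | (j < i)%N] by [].
apply/setP => y; rewrite -[y]gK !inE mem_map // mem_enum mem_imset //.
by rewrite /e !rK !inE.
Qed.

Lemma online_indep : indep M online.
Proof. by rewrite onlineE; have [] := greedy_base M [seq r i | i <- enum candidates]. Qed.

Lemma online_opt_lb :
  (2 * #|OPT M [set: T] :&: r @: [set i : 'I_#|T| | #|T|./2 <= i]| <=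
   #|OPT M [set: T] :&: online| + #|candidates|)%N.
Proof.
set O := OPT M _; set late := r @: _.
have [sub _ card_on] := greedy_base M [seq r i | i <- enum candidates].
have eC : [set x in [seq r i | i <- enum candidates]] = r @: candidates.
  apply/setP => x; rewrite inE; apply/mapP/imsetP => -[i iC ->]; exists i => //.
    by rewrite -mem_enum.
  by rewrite mem_enum.
rewrite -onlineE eC in sub card_on.
have sOC : O :&: late \subset r @: candidates.
  apply/subsetP => x /setIP[xO /imsetP[i]]; rewrite inE => lei ex.
  apply/imsetP; exists i => //; rewrite inE lei OPT_restrict -?ex //.
  by rewrite ex imset_f ?inE.
have indOl : indep M (O :&: late) by apply: indepS (subsetIl _ _) (OPT_indep M _).
have := leq_rank sOC indOl; rewrite -card_on => le1.
have sDC : online :\: O \subset r @: candidates :\: (O :&: late).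
  apply/subsetP => x; rewrite !inE => /andP[/negPf -> /(subsetP sub) ->] //.
have := subset_leq_card sDC; rewrite [leqRHS]cardsD (setIidPr sOC) card_imset //.
have := subset_leq_card sOC; rewrite card_imset // => le2 le3.
(* One copy of [#|O :&: late|] is bounded by [#|online|], which splits along [O]; the other is
   absorbed by the bound [#|candidates| - #|O :&: late|] on [#|online :\: O|]. *)
rewrite mul2n -addnn; apply: leq_trans (leq_add le1 (leqnn _)) _.
rewrite -(cardsID O online) setIC -addnA leq_add2l.
by rewrite -(subnK le2) leq_add2r.
Qed.

End Online.

(** * Symmetry of random arrival orders *)

Section Averaging.
Variable T : finType.
Local Notation arrivals := (arrival_orders T).

Lemma arrival_inj (r : {ffun 'I_#|T| -> T}) : r \in arrivals -> injective r.
Proof. by rewrite inE => /injectiveP. Qed.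

Lemma card_arrivals_gt0 : (0 < #|arrivals|)%N.
Proof.
apply/card_gt0P; exists [ffun i => enum_val i]; rewrite inE; apply/injectiveP.
by move=> i j; rewrite !ffunE; apply: enum_val_inj.
Qed.

(** Transposing positions [i] and [k] of [A] is an involution on arrival orders that fixes [r @: A],
    so all positions of [A] have equal counts; together they count each element of [F (r @: A)]
    once. *)
Lemma sum_position (F : {set T} -> {set T}) (A : {set 'I_#|T|}) (k : 'I_#|T|) :
    (forall Q, F Q \subset Q) -> k \in A ->
  (#|A| * \sum_(r in arrivals) (r k \in F (r @: A)))%N =
  (\sum_(r in arrivals) #|F (r @: A)|)%N.
Proof.
move=> subF kA.
have cardF r : r \in arrivals -> #|F (r @: A)| = (\sum_(i in A) (r i \in F (r @: A)))%N.
  move=> /arrival_inj r_inj; rewrite -big_mkcondr sum1dep_card -(card_imset _ r_inj).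
  apply: eq_card => x; apply/idP/imsetP => [xF|[i]].
    have /imsetP[i iA ex] := subsetP (subF _) x xF.
    by exists i; rewrite // inE iA -ex.
  by rewrite inE => /andP[_ ?] ->.
rewrite (eq_bigr _ cardF) exchange_big /= -sum_nat_const; apply: eq_bigr => i iA.
pose swap (r : {ffun 'I_#|T| -> T}) : {ffun 'I_#|T| -> T} := [ffun j => r (tperm i k j)].
have swapK : involutive swap by move=> r; apply/ffunP => j; rewrite !ffunE tpermK.
rewrite (reindex_inj (inv_inj swapK)); apply: eq_big => [r|r _].
  have swap_inj s : s \in arrivals -> swap s \in arrivals.
    move=> /arrival_inj s_inj; rewrite inE; apply/injectiveP => a b.
    by rewrite !ffunE => /s_inj /perm_inj.
  by apply/idP/idP => /swap_inj //; rewrite swapK.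
suff -> : swap r @: A = r @: A by rewrite ffunE tpermR.
have tA j : j \in A -> tperm i k j \in A by case: tpermP.
apply/setP => x; apply/imsetP/imsetP => -[j jA ->]; exists (tperm i k j); rewrite ?tA //.
  by rewrite ffunE.
by rewrite ffunE tpermK.
Qed.

End Averaging.

(** * Harmonic sum estimates *)

Section Numeric.
Variable R : realType.

(** [ln (1 - x) <= - x] at [x = 1 / (k + 1)] bounds each term by [ln (k + 1) - ln k], and for
    positive [h] these telescope to [ln (2h / h)]. *)
Lemma harmonic_ln2 h : \sum_(h <= k < h.*2) k.+1%:R^-1 <= ln 2 :> R.
Proof.
case: h => [|h]; first by rewrite big_geq // ln_ge0 // ler1n.
have step k : (h.+1 <= k < h.+1.*2)%N -> k.+1%:R^-1 <= ln k.+1%:R - ln k%:R :> R.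
  move=> /andP[ltk _]; have k0 : (0 < k)%N by apply: leq_ltn_trans ltk.
  have kR0 : 0 < k%:R :> R by rewrite ltr0n.
  have k1R0 : 0 < k.+1%:R :> R by rewrite ltr0n.
  rewrite -lerN2 opprB -ln_div ?posrE //.
  have -> : k%:R / k.+1%:R = 1 + - k.+1%:R^-1 :> R.
    have k1N0 := lt0r_neq0 k1R0; apply: (mulIf k1N0).
    by rewrite mulrBl mul1r mulVf // divfK // -natr1 addrK.
  apply: le_ln1Dx; rewrite ltrN2 invf_lt1 // ltr1n //.
rewrite big_seq; apply: le_trans (ler_sum _ _) _.
  by move=> k; rewrite mem_index_iota; apply: step.
rewrite -big_seq telescope_sumr; last by rewrite -addnn leq_addr.
rewrite -ln_div ?posrE ?ltr0n ?double_gt0 //.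
by rewrite -mul2n natrM mulfK // pnatr_eq0.
Qed.

Lemma threshold_sum n : (0 < n)%N ->
  1 - ln 2 <= \sum_(n./2 <= k < n) (2 / n%:R - k.+1%:R^-1) :> R.
Proof.
move=> n0; have nR : n%:R != 0 :> R by rewrite pnatr_eq0 -lt0n.
rewrite sumrB big_const_nat iter_addr_0 -[2 / _ *+ _]mulr_natr mulrAC -natrM.
have := harmonic_ln2 n./2; have := odd_double_half n.
set h := n./2; case: (odd n) => /= en le2.
  (* For odd [n = 2h + 1] the last term [1 / n] lies beyond the range of [harmonic_ln2], but
     [2 (n - h) / n = 1 + 1 / n] pays for it exactly. *)
  rewrite -[X in \sum_(h <= k < X) _]en big_nat_recr /=; last by rewrite -addnn leq_addr.
  have -> : (2 * (n - h) = n + 1)%N.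
    by rewrite -en -addnn add1n subSn ?leq_addr // addnK addn1 mul2n -addnn addnS.
  rewrite natrD mulrDl divff // mul1r -[h.*2.+1]/(1 + h.*2)%N en.
  by rewrite opprD addrACA subrr addr0 lerD2l lerN2.
rewrite -[X in \sum_(h <= k < X) _]en add0n.
have -> : (2 * (n - h) = n)%N by rewrite -en add0n -addnn addnK addnn mul2n.
by rewrite divff // lerD2l lerN2.
Qed.

End Numeric.

(** * The competitive ratio *)

Section Competitive.
Variable R : realType.

Lemma unit_prob_sum1 (n : nat) : \sum_(w : unit) (1 : R) = 1.
Proof. by rewrite sumr_const card_unit. Qed.

Definition threshold_algorithm : algorithm R :=
  @Algorithm R (fun _ => unit) (fun _ _ => 1) (fun _ _ => ler01) unit_prob_sum1
    (fun n _ m o => obs_accept n o).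

Lemma threshold_feasible : feasible threshold_algorithm.
Proof. by move=> d T M w r /arrival_inj r_inj; apply: online_indep. Qed.

Variables (d : Order.disp_t) (T : finOrderType d) (M : matroid T).
Local Notation n := #|T|.
Local Notation arrivals := (arrival_orders T).
Local Notation N := (#|arrivals|%:R : R).
Local Notation O := (OPT M [set: T]).
Local Notation rho := (#|O|%:R : R).

(** This is [sum_position] over all positions: [r @: setT] is the whole ground set, so every order
    counts [#|O|]. *)
Lemma sum_arrival_opt (k : 'I_n) :
  \sum_(r in arrivals) (r k \in O)%:R = N * rho / n%:R :> R.
Proof.
have nN0 : n%:R != 0 :> R by rewrite pnatr_eq0 -lt0n; apply: leq_trans (ltn_ord k).
apply: (mulfI nN0); rewrite [RHS]mulrC divfK //.
have := sum_position (OPT_subset M) (in_setT k).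
have im r : r \in arrivals -> r @: [set: 'I_n] = [set: T].
  move=> /arrival_inj r_inj; apply/eqP.
  by rewrite eqEcard subsetT card_imset // !cardsT card_ord /=.
rewrite (eq_bigr (fun r : {ffun 'I_n -> T} => r k \in O : nat)) => [|r /im -> //].
rewrite [RHS](eq_bigr (fun=> #|O|)) => [|r /im -> //].
by rewrite sum_nat_const cardsT card_ord -natr_sum -!natrM => ->.
Qed.

Lemma sum_arrival_candidate (k : 'I_n) :
  \sum_(r in arrivals) (r k \in OPT M (prefix r k))%:R <= N * rho / k.+1%:R :> R.
Proof.
rewrite ler_pdivlMr ?ltr0n // mulrC -natr_sum -!natrM ler_nat.
(* The symmetric positions are those up to and including [k], whence the denominator [k.+1]. *)
have k_in : k \in [set j : 'I_n | (j <= k)%N] by rewrite inE.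
have <- : #|[set j : 'I_n | (j <= k)%N]| = k.+1.
  by rewrite -sum1dep_card -(big_ord_widen n (fun=> 1)%N (ltn_ord k)) sum1_card card_ord.
rewrite (sum_position (OPT_subset M) k_in) -sum_nat_const.
by apply: leq_sum => r _; rewrite !card_OPT rankS ?subsetT.
Qed.

Lemma threshold_competitive :
  (1 - ln 2) * rho <= expected_intersection threshold_algorithm M.
Proof.
rewrite /expected_intersection (big_pred1 tt) => [|[]//].
rewrite [seed_prob _]/= mul1r; have N0 : 0 < N by rewrite ltr0n card_arrivals_gt0.
(* On an empty ground set the sum in [threshold_sum] is empty and its bound fails; there [rho = 0]
   settles the claim. *)
have [n0|n0] := posnP n.
  have -> : rho = 0.
    by apply/eqP; rewrite pnatr_eq0 -leqn0 -n0 max_card.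
  by rewrite mulr0 mulr_ge0 ?invr_ge0 ?ler0n ?sumr_ge0.
rewrite ler_pdivlMl // mulrCA.
apply: le_trans (ler_wpM2r _ (threshold_sum R n0)) _.
  by rewrite mulr_ge0 ?ler0n.
rewrite big_geq_mkord /= mulr_suml.
(* Summed over late positions, [gain r] is twice the number of late optimal elements minus the
   number of candidates, as in [online_opt_lb]. Summed over orders, each position dominates
   [N * rho] times its term in [threshold_sum]. *)
pose gain (r : {ffun 'I_n -> T}) (k : 'I_n) : R :=
  2 * (r k \in O)%:R - (r k \in OPT M (prefix r k))%:R.
apply: (@le_trans _ _ (\sum_(k < n | (n./2 <= k)%N) \sum_(r in arrivals) gain r k)).
  apply: ler_sum => k _; rewrite sumrB -mulr_sumr sum_arrival_opt mulrBl lerB //.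
    by rewrite mulrAC -!mulrA.
  by rewrite mulrC sum_arrival_candidate.
rewrite exchange_big; apply: ler_sum => r /arrival_inj r_inj.
rewrite sumrB -mulr_sumr -!natr_sum lerBlDr -natrM -natrD ler_nat.
have -> : (\sum_(k < n | n./2 <= k) (r k \in OPT M (prefix r k)))%N = #|candidates M r|.
  by rewrite -big_mkcondr sum1dep_card.
have -> : (\sum_(k < n | n./2 <= k) (r k \in O))%N =
    #|O :&: r @: [set k : 'I_n | (n./2 <= k)%N]|.
  rewrite -big_mkcondr sum1dep_card -(card_imset _ r_inj).
  apply: eq_card => x; rewrite inE; apply/imsetP/andP => [[k]|[xO /imsetP[k]]].
    by rewrite inE => /andP[lek kO] ->; rewrite kO imset_f ?inE.
  by rewrite inE => lek ex; exists k; rewrite // inE lek -ex.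
exact: online_opt_lb.
Qed.

End Competitive.

Theorem theorem1 (R : realType) :
  1 / (1 - ln 2) = 1 / ln (expR 1 / 2) :> R /\
  exists A : algorithm R,
    [/\ feasible A,
        intersection_competitive (1 / (1 - ln 2)) A &
        forall (d : Order.disp_t) (T : finOrderType d) (M : matroid T),
          ln (expR 1 / 2) * #|OPT M [set: T]|%:R <= expected_intersection A M].
Proof.
have -> : ln (expR 1 / 2) = 1 - ln 2 :> R.
  by rewrite ln_div ?expRK // posrE ?expR_gt0 ?ltr0n.
split=> //; exists (threshold_algorithm R); split=> [|d T M|d T M].
- exact: threshold_feasible.
- by rewrite div1r invrK mulrC; apply: threshold_competitive.
exact: threshold_competitive.
Qed.
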